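(* Let $G$ and $H$ be graphs with $G$ connected. Then $$\xi(G \odot H) \ge \beta(\widehat{G})\,\mathrm{n}(H) + \alpha(\widehat{G}) + \beta^*(G).$$
   Context: All graphs are finite, simple and undirected; $\mathrm{n}(H)$ denotes the order of $H$. For a connected graph $\Gamma$, a set $S\subseteq V(\Gamma)$ is a distance-equalizer set if for every two distinct $u,v\in V(\Gamma)\setminus S$ there is $w\in S$ with $d_\Gamma(w,u)=d_\Gamma(w,v)$; $\xi(\Gamma)$ is the minimum cardinality of a distance-equalizer set of $\Gamma$. For $V(G)=\{v_1,\dots,v_n\}$, the corona product $G\odot H$ is obtained from $G$ and $n$ pairwise disjoint copies $H_1,\dots,H_n$ of $H$ by joining $v_i$ to every vertex of $H_i$, for each $i$. For distinct $u,v\in V(G)$ the bisector is $B_G(u\mid v)=\{w\in V(G): d_G(w,u)=d_G(w,v)\}$. The empty bisector graph $\widehat{G}$ has vertex set $V(G)$, with $u,v$ adjacent iff $B_G(u\mid v)=\varnothing$. $\alpha$ denotes the independence number and $\beta$ the vertex cover number. A pair $(X,Y)$ of subsets of $V(G)$ with $X\cup Y=V(G)$ is a forward-equalized pair of $G$ if for every $(u,v)\in (X\setminus Y)\times(Y\setminus X)$ there exists $w\in V(G)$ with $d_G(w,u)=d_G(w,v)+1$. Finally $\beta^*(G)=\min\{|X\cap Y| : X,Y \text{ are vertex covers of } \widehat{G} \text{ and } (X,Y) \text{ is a forward-equalized pair of } G\}$. *)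

(* Defs.v *)
From mathcomp Require Import all_boot.

Set Implicit Arguments.
Unset Strict Implicit.
Unset Printing Implicit Defensive.

(* Graphs are non-null, as usual: the lower bound on the corona product fails
   when the second factor has no vertices. *)
Record sgraph := SGraph {
  vertex :> finType;
  adj : rel vertex;
  adj_sym : symmetric adj;
  adj_irrefl : irreflexive adj;
  order_gt0 : 0 < #|vertex| }.

Definition connected (G : sgraph) : Prop :=
  forall x y : G, connect (@adj G) x y.

(* The least length of a walk from [x] to [y]; a shortest walk has fewer than
   [#|G|] edges.  The value is [#|G|] when there is no walk at all. *)
Definition dist (G : sgraph) (x y : G) : nat :=
  find (fun k => [exists p : k.-tuple G, path (@adj G) x p && (last x p == y)])
       (iota 0 #|G|).

Definition distance_equalizer (G : sgraph) (S : {set G}) : bool :=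
  [forall u, forall v,
     [&& u \notin S, v \notin S & u != v] ==>
     [exists w in S, dist w u == dist w v]].

Lemma distance_equalizerT (G : sgraph) : distance_equalizer [set: G].
Proof. by apply/forallP=> u; apply/forallP=> v; rewrite inE. Qed.

(* By [distance_equalizerT] the minimum is over a nonempty family. *)
Definition xi (G : sgraph) : nat :=
  #|[arg min_(S < [set: G] | distance_equalizer S) #|S| ]|.

Section Corona.
Variables G H : sgraph.

(* [inl v] is the vertex [v] of [G]; [inr (v, h)] is the vertex [h] in the copy
   of [H] attached to [v]. *)
Definition corona_adj : rel (G + G * H) := fun x y =>
  match x, y with
  | inl u, inl v => adj u v
  | inl u, inr (v, _) => u == v
  | inr (u, _), inl v => u == v
  | inr (u, h), inr (v, k) => (u == v) && adj h k
  end.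

Lemma corona_sym : symmetric corona_adj.
Proof.
by case=> [u|[u h]] [v|[v k]] /=; rewrite 1?adj_sym // eq_sym // adj_sym.
Qed.

Lemma corona_irrefl : irreflexive corona_adj.
Proof. by case=> [u|[u h]] /=; rewrite adj_irrefl ?andbF. Qed.

Lemma corona_order_gt0 : 0 < #|{: G + G * H}|.
Proof. by rewrite card_sum addn_gt0 order_gt0. Qed.

Definition corona : sgraph := SGraph corona_sym corona_irrefl corona_order_gt0.

End Corona.

Section EmptyBisectorGraph.
Variable G : sgraph.

Definition bisector (u v : G) : {set G} := [set w | dist w u == dist w v].

Definition ebg_adj : rel G := fun u v => (u != v) && (bisector u v == set0).

Lemma bisectorC (u v : G) : bisector u v = bisector v u.
Proof. by apply/setP=> w; rewrite !inE eq_sym. Qed.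

Lemma ebg_sym : symmetric ebg_adj.
Proof. by move=> u v; rewrite /ebg_adj eq_sym bisectorC. Qed.

Lemma ebg_irrefl : irreflexive ebg_adj.
Proof. by move=> u; rewrite /ebg_adj eqxx. Qed.

Definition empty_bisector_graph : sgraph :=
  SGraph ebg_sym ebg_irrefl (order_gt0 G).

End EmptyBisectorGraph.

Definition independent (G : sgraph) (S : {set G}) : bool :=
  [forall u in S, forall v in S, ~~ adj u v].

Definition alpha (G : sgraph) : nat :=
  \max_(S : {set G} | independent S) #|S|.

Definition vertex_cover (G : sgraph) (S : {set G}) : bool :=
  [forall u, forall v, adj u v ==> (u \in S) || (v \in S)].

Lemma vertex_coverT (G : sgraph) : vertex_cover [set: G].
Proof. by apply/forallP=> u; apply/forallP=> v; rewrite inE implybT. Qed.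

(* By [vertex_coverT] the minimum is over a nonempty family. *)
Definition beta (G : sgraph) : nat :=
  #|[arg min_(S < [set: G] | vertex_cover S) #|S| ]|.

Definition forward_equalized (G : sgraph) (X Y : {set G}) : bool :=
  (X :|: Y == [set: G]) &&
  [forall u in X :\: Y, forall v in Y :\: X,
     exists w : G, dist w u == (dist w v).+1].

Definition beta_star_feasible (G : sgraph) (p : {set G} * {set G}) : bool :=
  [&& @vertex_cover (empty_bisector_graph G) p.1,
      @vertex_cover (empty_bisector_graph G) p.2
    & forward_equalized p.1 p.2].

Lemma beta_star_feasibleT (G : sgraph) :
  beta_star_feasible ([set: G], [set: G]).
Proof.
apply/and3P; split; try exact: (@vertex_coverT (empty_bisector_graph G)).
rewrite /forward_equalized setUT eqxx /=.
by apply/forallP=> u; rewrite !inE.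
Qed.

(* By [beta_star_feasibleT] the minimum is over a nonempty family. *)
Definition beta_star (G : sgraph) : nat :=
  let p := [arg min_(p < ([set: G], [set: G]) | beta_star_feasible p)
              #|p.1 :&: p.2| ] in
  #|p.1 :&: p.2|.

(* Main.v *)
Require Import Defs.
From mathcomp Require Import all_boot.
From mathcomp Require Import zify.

(** Let [S] be a distance-equalizer set of the corona product.  Let [U] be the set
    of vertices of [G] whose copy of [H] lies inside [S], [X] the set of those
    whose copy meets [S], and [Y] the trace of [S] on [G].  Distances in the
    corona are distances in [G] plus the number of endpoints outside [G] (except
    inside a single copy), so [U] and [Y] are vertex covers of the empty bisector
    graph, hence so is [X] (which contains [U]), and [(X, Y)] is
    forward-equalized.  Each vertex of [U] contributes a whole copy of [H] to [S]
    and each vertex of [X :\: U] contributes at least one vertex, so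
    [|S| >= |U| |H| + |X| - |U| + |Y|], and [|X| + |Y| = |G| + |X :&: Y|]; since
    [|H| >= 1], [|U|] may be replaced by the smaller [beta], and finally
    [|G| - beta >= alpha]. *)

Set Implicit Arguments.
Unset Strict Implicit.
Unset Printing Implicit Defensive.

(** * Walks and distances in a connected graph *)

Section Distance.
Variable G : sgraph.
Implicit Types (x y z : G) (p : seq G).

Lemma dist_le_size x p : path (@adj G) x p -> dist x (last x p) <= size p.
Proof.
move=> xp; rewrite /dist; set a := fun k => _.
have ap : a (size p) by apply/existsP; exists (in_tuple p); rewrite xp eqxx.
(* For a walk with at least [#|G|] edges the bound is automatic: [find] never exceeds the length
   [#|G|] of the searched list. *)
case: (ltnP (size p) #|G|) => [lt_pG|le_Gp]; last first.
  by apply: leq_trans le_Gp; rewrite -[X in _ <= X](size_iota 0) find_size.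
rewrite leqNgt; apply/negP => /(before_find 0).
by rewrite nth_iota // add0n ap.
Qed.

Hypothesis hG : connected G.

Lemma dist_path x y :
  exists p, [/\ path (@adj G) x p, last x p = y & size p = dist x y].
Proof.
case/connectP: (hG x y) => q xq ->{y}.
(* A walk without repeated vertices has fewer than [#|G|] edges, so its length lies in the searched
   range and [find] does not fall back on its default. *)
case/shortenP: xq => p xp up _.
have lt_pG : size p < #|G|.
  by have := max_card (mem (x :: p)); rewrite (card_uniqP up).
have : has (fun k => [exists t : k.-tuple G,
                        path (@adj G) x t && (last x t == last x p)])
           (iota 0 #|G|).
  apply/hasP; exists (size p); first by rewrite mem_iota.
  by apply/existsP; exists (in_tuple p); rewrite xp eqxx.
move=> h; have := nth_find 0 h; move: h; rewrite has_find size_iota => h.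
rewrite nth_iota // add0n => /existsP[t /andP[xt /eqP lt]].
by exists t; rewrite size_tuple.
Qed.

Lemma dist_triangle x y z : dist x z <= dist x y + dist y z.
Proof.
have [p [xp <- <-]] := dist_path x y.
have [q [yq <- <-]] := dist_path (last x p) z.
by rewrite -last_cat -size_cat; apply: dist_le_size; rewrite cat_path xp.
Qed.

Lemma dist_refl x : dist x x = 0.
Proof. by apply/eqP; rewrite -leqn0 (@dist_le_size x [::]). Qed.

Lemma dist_adj x y : adj x y -> dist x y <= 1.
Proof. by move=> xy; apply: (@dist_le_size x [:: y]); rewrite /= xy. Qed.

Lemma dist_adjr x y z : adj y z -> dist x z <= (dist x y).+1.
Proof.
by move/dist_adj => yz; have := dist_triangle x y z; lia.
Qed.

Lemma dist_gt0 x y : x != y -> 0 < dist x y.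
Proof.
move=> xy; have [[|z p] [_ /= xy' <-]] := dist_path x y => //.
by rewrite xy' eqxx in xy.
Qed.

(** The tool for lower bounds on distances: a guessed formula that grows by at most one along each
    edge cannot outrun a shortest walk. *)
Lemma lipschitz_le_dist (f : G -> nat) x y :
  (forall a b, adj a b -> f b <= (f a).+1) -> f y <= f x + dist x y.
Proof.
move=> fL; have [p [xp <- <-]] := dist_path x y.
elim: p x xp => [|z p IHp] x /=; first by rewrite addn0.
by case/andP=> /fL xz /IHp; lia.
Qed.

End Distance.

(** * Empty bisectors, vertex covers and independent sets *)

Lemma bisectorP (G : sgraph) (u v : G) :
  u != v -> reflect (exists x, dist x u = dist x v) (~~ ebg_adj u v).
Proof.
move=> uv; rewrite /ebg_adj uv /=; apply: (iffP (set0Pn _)) => -[x].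
  by rewrite inE => /eqP; exists x.
by exists x; rewrite inE; apply/eqP.
Qed.

Lemma beta_le (G : sgraph) (S : {set G}) : vertex_cover S -> beta G <= #|S|.
Proof.
by rewrite /beta; case: arg_minnP => [|T _ minT /minT //]; apply: vertex_coverT.
Qed.

Lemma vertex_coverC (G : sgraph) (S : {set G}) :
  independent S -> vertex_cover (~: S).
Proof.
move=> /forall_inP iS; apply/forallP => u; apply/forallP => v.
apply/implyP => uv; rewrite !inE -negb_and; apply/negP => /andP[uS vS].
by have /forall_inP/(_ v vS) := iS u uS; rewrite uv.
Qed.

Lemma beta_add_alpha_le (G : sgraph) : beta G + alpha G <= #|G|.
Proof.
have leG : beta G <= #|G| by rewrite -cardsT beta_le ?vertex_coverT.
(* The maximum [alpha] must stand alone to be bounded set by set; [leG] keeps the truncated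
   subtraction exact. *)
suff : alpha G <= #|G| - beta G by lia.
apply/bigmax_leqP => S /vertex_coverC/beta_le.
by have := cardsC S; lia.
Qed.

Lemma beta_star_le (G : sgraph) (X Y : {set G}) :
  beta_star_feasible (X, Y) -> beta_star G <= #|X :&: Y|.
Proof.
rewrite /beta_star; case: arg_minnP => [|p _ minp /minp //].
exact: beta_star_feasibleT.
Qed.

(** The result type is the graph [corona G H], not the bare sum type, so that [dist] and [adj] are
    those of the corona. *)
Definition base_vertex (G H : sgraph) (x : G) : corona G H := inl x.

Definition copy_vertex (G H : sgraph) (x : G) (h : H) : corona G H := inr (x, h).

Variant corona_vertex_spec (G H : sgraph) : corona G H -> Type :=
  | BaseVertex x : corona_vertex_spec (base_vertex H x)
  | CopyVertex x (h : H) : corona_vertex_spec (copy_vertex x h).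

Lemma corona_vertexP (G H : sgraph) (w : corona G H) : corona_vertex_spec w.
Proof. by case: w => [x|[x h]]; constructor. Qed.

(** * Distances in the corona product *)

Section CoronaDistance.
Variables (G H : sgraph) (hG : connected G).
Local Notation C := (corona G H).
Implicit Types (x u : G) (h k : H).
Local Notation cl := (@base_vertex G H).
Local Notation cr := (@copy_vertex G H).

Lemma corona_connected : connected C.
Proof.
have ll x u : connect (@adj C) (cl x) (cl u).
  have [p [xp <- _]] := dist_path hG x u.
  apply/connectP; exists (map cl p); last by rewrite last_map.
  by rewrite path_map.
have lr x h : connect (@adj C) (cl x) (cr x h) by apply/connect1/eqxx.
have rl x h : connect (@adj C) (cr x h) (cl x) by apply/connect1/eqxx.
case=> [x|[x h]] [u|[u k]]; first exact: ll.
- exact: connect_trans (ll x u) (lr u k).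
- exact: connect_trans (rl x h) (ll x u).
- exact: connect_trans (rl x h) (connect_trans (ll x u) (lr u k)).
Qed.
Let hC := corona_connected.

Lemma corona_dist_ll_le x u : dist (cl x) (cl u) <= dist x u.
Proof.
have [p [xp <- <-]] := dist_path hG x u.
rewrite -(last_map cl) -(size_map cl); apply: dist_le_size.
by rewrite path_map.
Qed.

Lemma adj_corona_lr x h : adj (cl x) (cr x h).
Proof. exact: eqxx. Qed.

Lemma adj_corona_rl x h : adj (cr x h) (cl x).
Proof. exact: eqxx. Qed.

(** A potential for [lipschitz_le_dist] that vanishes at [cl x]; it turns out to be the distance
    from there. *)
Let dist_from_l x (a : C) : nat :=
  match a with inl u => dist x u | inr (u, _) => (dist x u).+1 end.

Let dist_from_l_lip x (a b : C) :
  adj a b -> dist_from_l x b <= (dist_from_l x a).+1.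
Proof.
case: a b => [u|[u h]] [v|[v k]] /=; first exact: dist_adjr.
- by move/eqP->.
- by move/eqP->; lia.
- by case/andP=> /eqP->.
Qed.

Lemma corona_dist_ll x u : dist (cl x) (cl u) = dist x u.
Proof.
apply/eqP; rewrite eqn_leq corona_dist_ll_le /=.
have := lipschitz_le_dist hC (cl x) (cl u) (@dist_from_l_lip x).
by rewrite /= dist_refl.
Qed.

Lemma corona_dist_lr x u h : dist (cl x) (cr u h) = (dist x u).+1.
Proof.
apply/eqP; rewrite eqn_leq -{1}corona_dist_ll.
rewrite (dist_adjr hC _ (adj_corona_lr u h)) /=.
have := lipschitz_le_dist hC (cl x) (cr u h) (@dist_from_l_lip x).
by rewrite /= dist_refl.
Qed.

(** The value 0 on the whole copy at [x] keeps the adjacency of [H] out of the argument; outside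
    that copy this is the true distance from each of its vertices. *)
Let dist_from_r x (a : C) : nat :=
  match a with
  | inl u => (dist x u).+1
  | inr (u, _) => if u == x then 0 else (dist x u).+2
  end.

Let dist_from_r_lip x (a b : C) :
  adj a b -> dist_from_r x b <= (dist_from_r x a).+1.
Proof.
case: a b => [u|[u h]] [v|[v k]] /=.
- by move/(dist_adjr hG x).
- by move/eqP->; case: ifP.
- by move/eqP->; case: eqVneq => [->|_]; rewrite ?dist_refl //; lia.
- by case/andP=> /eqP->.
Qed.

Lemma corona_dist_rl x k u : dist (cr x k) (cl u) = (dist x u).+1.
Proof.
apply/eqP; rewrite eqn_leq; apply/andP; split.
  have := dist_triangle hC (cr x k) (cl x) (cl u).
  by have := dist_adj (adj_corona_rl x k); rewrite corona_dist_ll; lia.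
have := lipschitz_le_dist hC (cr x k) (cl u) (@dist_from_r_lip x).
by rewrite /= eqxx.
Qed.

(** The case [x = u] matters: two vertices of one copy are within distance 2, through their base
    vertex. *)
Lemma corona_dist_rr_le x k u h : dist (cr x k) (cr u h) <= (dist x u).+2.
Proof.
by rewrite -(corona_dist_rl x k); apply: dist_adjr (adj_corona_lr u h).
Qed.

Lemma corona_dist_rr x k u h :
  x != u -> dist (cr x k) (cr u h) = (dist x u).+2.
Proof.
move=> xu; apply/eqP; rewrite eqn_leq corona_dist_rr_le /=.
have := lipschitz_le_dist hC (cr x k) (cr u h) (@dist_from_r_lip x).
by rewrite /= eqxx eq_sym (negPf xu).
Qed.

End CoronaDistance.

(** * Traces of a distance-equalizer set on the copies and on the base *)

Section Equalizer.
Variables (G H : sgraph) (S : {set corona G H}).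
Implicit Types (x u v : G) (h k : H).
Local Notation C := (corona G H).
Local Notation cl := (@base_vertex G H).
Local Notation cr := (@copy_vertex G H).

Definition copy_trace u : {set H} := [set h | cr u h \in S].
Definition full_copies : {set G} := [set u | copy_trace u == setT].
Definition met_copies : {set G} := [set u | copy_trace u != set0].
Definition base_trace : {set G} := [set u | cl u \in S].

Lemma full_copiesPn u : u \notin full_copies -> exists h, cr u h \notin S.
Proof.
rewrite inE -subTset => /subsetPn[h _]; rewrite inE => uh.
by exists h.
Qed.

Lemma met_copiesPn u h : u \notin met_copies -> cr u h \notin S.
Proof. by rewrite inE negbK => /eqP/setP/(_ h); rewrite !inE => ->. Qed.

Lemma full_sub_met : full_copies \subset met_copies.
Proof.
apply/subsetP => u; rewrite !inE => /eqP->.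
by rewrite -card_gt0 cardsT Defs.order_gt0.
Qed.

Lemma card_trace : #|S| = #|base_trace| + \sum_u #|copy_trace u|.
Proof.
rewrite -!sum1_card big_mkcond /= big_sumType /=.
congr (_ + _).
  by rewrite [RHS]big_mkcond /=; apply: eq_bigr => u _; rewrite inE.
rewrite (eq_bigr (fun p => if cr p.1 p.2 \in S then 1 else 0)) => [|[] //].
rewrite -(pair_bigA _ (fun u h => if cr u h \in S then 1 else 0)) /=.
apply: eq_bigr => u _; rewrite -sum1_card [RHS]big_mkcond /=.
by apply: eq_bigr => h _; rewrite inE.
Qed.

(** The comparison is made copy by copy: a full copy counts [#|H| + 1] on both sides, and a copy
    that is met but not full counts 1 against a nonempty trace. Adding [#|full_copies|] on the right
    avoids subtraction. *)
Lemma card_trace_ge :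
  #|full_copies| * #|H| + #|met_copies| + #|base_trace| <= #|S| + #|full_copies|.
Proof.
rewrite card_trace.
suff : #|full_copies| * #|H| + #|met_copies|
       <= \sum_u #|copy_trace u| + #|full_copies| by lia.
rewrite -sum_nat_const -!sum1_card big_mkcond /= (big_mkcond (mem met_copies)) /=.
rewrite (big_mkcond (mem full_copies)) /= -!big_split /=.
apply: leq_sum => u _; have /subsetP/(_ u) := full_sub_met.
case: (boolP (u \in full_copies)) => [|_ _].
  move=> uF /(_ isT) ->; move: uF; rewrite inE => /eqP->.
  by rewrite cardsT sum1_card.
by rewrite addn0; case: ifP; rewrite // inE card_gt0.
Qed.

Hypotheses (hG : connected G) (eqS : distance_equalizer S).

Lemma equalizerP (a b : C) :
  a \notin S -> b \notin S -> a != b -> exists2 w, w \in S & dist w a = dist w b.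
Proof.
move=> aS bS ab; have /forallP/(_ a)/forallP/(_ b) := eqS.
by rewrite aS bS ab => /exists_inP[w wS /eqP]; exists w.
Qed.

Lemma vertex_cover_full : @vertex_cover (empty_bisector_graph G) full_copies.
Proof.
apply/forallP => u; apply/forallP => v; apply/implyP => /= uv.
apply/negPn/negP; rewrite negb_or.
case/andP=> /full_copiesPn[h uh] /full_copiesPn[k vk].
have nuv : u != v by case/andP: uv.
apply/negP: uv; apply/bisectorP => //.
have [|w _] := equalizerP uh vk; last case: (corona_vertexP w) => [x|x l].
- by apply: contra nuv => /eqP[->].
- by rewrite !corona_dist_lr // => -[]; exists x.
(* A vertex of the copy at [u] is within 2 of [cr u h] but at least 3 away from [cr v k], so it
   cannot equalize them; likewise at [v]. Hence [x] differs from both and the offsets cancel. *)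
- case: (eqVneq x u) => [->|xu].
    have := corona_dist_rr_le hG u l u h; rewrite dist_refl.
    by rewrite (corona_dist_rr hG _ _ nuv); have := dist_gt0 hG nuv; lia.
  case: (eqVneq x v) => [->|xv].
    have := corona_dist_rr_le hG v l v k; rewrite dist_refl.
    have nvu : v != u by rewrite eq_sym.
    by rewrite (corona_dist_rr hG _ _ nvu); have := dist_gt0 hG nvu; lia.
  by rewrite !corona_dist_rr // => -[]; exists x.
Qed.

Lemma vertex_cover_met : @vertex_cover (empty_bisector_graph G) met_copies.
Proof.
apply/forallP => u; apply/forallP => v; apply/implyP => uv.
have /forallP/(_ u)/forallP/(_ v)/implyP/(_ uv) := vertex_cover_full.
by case/orP=> /(subsetP full_sub_met)->; rewrite ?orbT.
Qed.

Lemma vertex_cover_base : @vertex_cover (empty_bisector_graph G) base_trace.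
Proof.
apply/forallP => u; apply/forallP => v; apply/implyP => /= uv.
apply/negPn/negP; rewrite negb_or !inE => /andP[uS vS].
have nuv : u != v by case/andP: uv.
apply/negP: uv; apply/bisectorP => //.
have [|w _] := equalizerP uS vS; last case: (corona_vertexP w) => [x|x l].
- by apply: contra nuv => /eqP[->].
- by rewrite !corona_dist_ll //; exists x.
- by rewrite !corona_dist_rl // => -[]; exists x.
Qed.

(** The pair to equalize is mixed, [cl u] against [cr v h]: the extra edge from [cl v] to [cr v h]
    produces the successor. The equalizing vertex is not in the copy at [v], which misses [S]. *)
Lemma forward_equalized_met_base : forward_equalized met_copies base_trace.
Proof.
case/card_gt0P: (Defs.order_gt0 H) => h _.
have key u v : u \notin base_trace -> v \notin met_copies ->
    exists w : G, dist w u = (dist w v).+1.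
  rewrite inE => uS vX; have vS := met_copiesPn h vX.
  have [//|w] := equalizerP uS vS; case: (corona_vertexP w) => [x|x l] wS.
  - by rewrite corona_dist_ll // corona_dist_lr //; exists x.
  - have xv : x != v.
      by apply: contraTneq wS => ->; apply: met_copiesPn.
    by rewrite corona_dist_rl // corona_dist_rr // => -[]; exists x.
apply/andP; split.
  apply/eqP/setP => v; rewrite [RHS]inE in_setU.
  apply/negPn/negP; rewrite negb_or => /andP[vX vY].
  by have [w] := key v v vY vX; lia.
apply/forall_inP => u; rewrite in_setD => /andP[uY _].
apply/forall_inP => v; rewrite in_setD => /andP[vX _].
by have [w ww] := key u v uY vX; apply/existsP; exists w; apply/eqP.
Qed.

End Equalizer.

Theorem theorem17 (G H : sgraph) (hG : connected G) :
  xi (corona G H) >=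
    beta (empty_bisector_graph G) * #|H| + alpha (empty_bisector_graph G)
    + beta_star G.
Proof.
rewrite /xi; case: arg_minnP => [|S eqS _]; first exact: distance_equalizerT.
(* Here [n], [g], [s] are the sizes of [H], [G], [S]; [x], [y], [i] those of [met_copies S],
   [base_trace S] and their intersection; [u] that of [full_copies S]; and [b], [a], [c] stand for
   [beta], [alpha], [beta_star]. Since [n] is positive, [u * (n - 1)] is at least [b * (n - 1)], and
   the missing [b + a] comes out of [g]. *)
have arith (n g i x y c u s b a : nat) : 0 < n -> g + i = x + y -> c <= i ->
    u * n + x + y <= s + u -> b + a <= g -> b <= u -> b * n + a + c <= s by nia.
have fe := forward_equalized_met_base hG eqS.
have := beta_le (vertex_cover_full hG eqS).
have := beta_add_alpha_le (empty_bisector_graph G).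
have := card_trace_ge S.
have /beta_star_le : beta_star_feasible (met_copies S, base_trace S).
  by rewrite /beta_star_feasible /= vertex_cover_met ?vertex_cover_base.
have := cardsUI (met_copies S) (base_trace S).
have /eqP-> : met_copies S :|: base_trace S == setT by case/andP: fe.
rewrite cardsT; apply: arith (Defs.order_gt0 H).
Qed.
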